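(* Let $n$ be a positive integer and let $\varphi(\{NE,D\}^n)=\bigcup_{\gamma\in\{NE,D\}^n}\varphi(\gamma)$, where each sequence $\varphi(\gamma)$ is regarded as the set of its elements. There is a bijection $\Omega_n$ of $\varphi(\{NE,D\}^n)$ onto itself such that, for every $\pi\in\varphi(\{NE,D\}^n)$, $\mathrm{area}(\pi)=\mathrm{bounce}(\Omega_n(\pi))$ and $\mathrm{bounce}(\pi)=\mathrm{area}(\Omega_n(\pi))$.
   Context: Words in $N=(0,1)$, $E=(1,0)$, $D=(1,1)$ are read as lattice paths starting at $(0,0)$. A Schröder path is such a word with as many $N$'s as $E$'s and with $|\omega|_N\ge|\omega|_E$ for every prefix $\omega$; its size is the number of $N$'s plus the number of $D$'s. A Dyck path is a Schröder path without $D$ steps. $\{NE,D\}^n$ is the set of words that are concatenations of $n$ blocks, each equal to $NE$ or $D$. Area: $\mathrm{area}(\gamma)$ is the number of lower triangles (lower halves of unit squares cut along the diagonal from bottom left to top right corner) under the path and above the main diagonal; equivalently the sum of $y-x$ over all $N$ and $D$ steps of $\gamma$, $(x,y)$ being the starting point of the step. Bounce: for a Dyck path of size $k$, the bounce path starts at $(0,0)$, goes north until it reaches the starting point of an east step of the Dyck path, then east until it reaches the main diagonal, then north again, and so on until $(k,k)$; the bounce of the Dyck path is the sum of $k-j$ over all points $(j,j)$, $1\le j\le k$, at which the bounce path returns to the main diagonal. For a Schröder path $\gamma$, let $\Gamma(\gamma)$ be the Dyck path obtained by deleting all $D$ steps. The points where the bounce path of $\Gamma(\gamma)$ turns from north to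 east are starting points of east steps of $\Gamma(\gamma)$; the corresponding east steps of $\gamma$ are the peak steps. Then $\mathrm{numph}(\gamma)$ is the sum over all $D$ steps of $\gamma$ of the number of peak steps preceding that $D$ step in the word, and $\mathrm{bounce}(\gamma)=\mathrm{bounce}(\Gamma(\gamma))+\mathrm{numph}(\gamma)$. Algorithm $\varphi$: for $\gamma\in\{NE,D\}^*$, $\varphi(\gamma)=(\gamma_0,\gamma_1,\dots,\gamma_{\mathrm{bounce}(\gamma)})$, where $\gamma_0=\gamma$ and $\gamma_v$ is obtained from $\gamma_{v-1}=w_1\cdots w_k$ by taking the largest index $i<k$ with $w_i=E$ and $w_{i+1}\ne E$ and exchanging $w_i$ and $w_{i+1}$. *)

(* Defs.v *)
(* MathComp, with the classical sets of MathComp-Analysis. *)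
From HB Require Import structures.
From mathcomp Require Import all_boot.
From mathcomp Require Import classical_sets functions.

Set Implicit Arguments.
Unset Strict Implicit.
Unset Printing Implicit Defensive.

Local Open Scope nat_scope.
Local Open Scope classical_set_scope.

Inductive step := N | E | D.

Definition option_of_step (s : step) : option bool :=
  match s with N => Some true | E => Some false | D => None end.
Definition step_of_option (o : option bool) : step :=
  match o with Some true => N | Some false => E | None => D end.
Lemma option_of_stepK : cancel option_of_step step_of_option.
Proof. by case. Qed.
HB.instance Definition _ := Finite.copy step (can_type option_of_stepK).

Definition word := seq step.

(* D = (1, 1) advances both coordinates. *)
Definition endpoint (w : word) : nat * nat :=
  (count_mem E w + count_mem D w, count_mem N w + count_mem D w).

(* Starting point of the step of w with (0-based) index i. *)
Definition start (w : word) (i : nat) : nat * nat := endpoint (take i w).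

(* The truncated subtraction is exact on Schroder paths, where x <= y. *)
Definition area (w : word) : nat :=
  \sum_(i < size w | nth E w i != E) ((start w i).2 - (start w i).1).

Definition east_starts (w : word) : seq (nat * nat) :=
  [seq start w i | i <- iota 0 (size w) & nth N w i == E].

(* Height at which the bounce path of the Dyck path w, going north from (j, j),
   meets the starting point of an east step of w. *)
Definition north_until (w : word) (j : nat) : nat :=
  j + find (fun y => (j, y) \in east_starts w) (iota j (size w)).

(* North-to-east turning points of the bounce path of w from (j, j) on. On a
   Dyck path of size k and j < k one has j < north_until w j <= k, so that k
   units of fuel suffice to reach (k, k). *)
Fixpoint turns_from (w : word) (fuel j : nat) : seq (nat * nat) :=
  if fuel is fuel'.+1 then
    if j < count_mem N w then
      let y := north_until w j in (j, y) :: turns_from w fuel' y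
    else [::]
  else [::].

Definition turns (w : word) : seq (nat * nat) :=
  turns_from w (count_mem N w) 0.

(* After turning at (x, y) the bounce path returns to the diagonal at (y, y). *)
Definition dyck_bounce (w : word) : nat :=
  \sum_(p <- turns w) (count_mem N w - p.2).

Definition Gam (w : word) : word := [seq s <- w | s != D].

(* An east step of w preceded by the prefix take i w corresponds to the east
   step of Gam w preceded by Gam (take i w). *)
Definition is_peak_step (w : word) (i : nat) : bool :=
  (nth N w i == E) && (endpoint (Gam (take i w)) \in turns (Gam w)).

Definition numph (w : word) : nat :=
  \sum_(d < size w | nth E w d == D) count (is_peak_step w) (iota 0 d).

Definition bounce (w : word) : nat := dyck_bounce (Gam w) + numph w.

Definition NED (n : nat) : set word :=
  [set w | exists bs : seq word,
     [/\ size bs = n, all (mem [:: [:: N; E]; [:: D]]) bs & w = flatten bs]].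

Definition exchangeable (w : word) (i : nat) : bool :=
  [&& i.+1 < size w, nth E w i == E & nth E w i.+1 != E].

Definition exchange (w : word) (i : nat) : word :=
  take i w ++ [:: nth E w i.+1; nth E w i] ++ drop i.+2 w.

(* The identity when no index is exchangeable; this does not happen in the
   first bounce w steps from a word w in NED n. *)
Definition phi_step (w : word) : word :=
  if [seq i <- iota 0 (size w) | exchangeable w i] is i :: s
  then exchange w (last i s) else w.

(* The sequence (w_0, ..., w_(bounce w)). *)
Definition phi (w : word) : seq word := traject phi_step w (bounce w).+1.

Definition phi_image (n : nat) : set word :=
  \bigcup_(w in NED n) [set` phi w].

(* Main.v *)
(** A word of [{NE,D}^n] is determined by its subword of [N] and [D] steps,
    which [phi_step] preserves, so the sequences [phi w] are pairwise disjoint.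
    Along [phi w] the area starts from [0] and increases by [1] at each step
    while the bounce decreases by [1]; hence reversing every sequence exchanges
    the two statistics. *)
Require Import Defs.
From mathcomp Require Import all_boot.
From mathcomp Require Import classical_sets functions.
From mathcomp Require Import zify.

(** * Shapes of the words in a sequence *)

Definition blocks (bs : seq word) : bool :=
  all (mem [:: [:: N; E]; [:: D]]) bs.

(** The shape of every word of a sequence [phi w], except possibly the last
    one: the [E] in the middle is the one that moves, and the [E]'s on its right
    have reached their final positions. *)
Definition moving (bs : seq word) (x y : word) : word :=
  flatten bs ++ N :: x ++ E :: y ++ nseq (count_mem N x + count_mem N y) E.

Definition settled (x : word) : word := x ++ nseq (count_mem N x) E.

Definition active (w : word) : Prop :=
  exists bs x s y, [/\ blocks bs, E \notin x, E \notin s :: y &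
    w = moving bs x (s :: y)].

(** All [E]'s stand at the end, so no exchange is possible; the bounce is then [0] ([bounce_stuck]),
    hence such a word can only end a sequence. *)
Definition stuck (w : word) : Prop := exists2 x, E \notin x & w = settled x.

(** * Sums over the steps of a word, and their change under an exchange *)

Definition step_sum (P : pred step) (f : word -> nat) (w : word) : nat :=
  \sum_(i < size w | P (nth E w i)) f (take i w).

Lemma step_sum_nil P f : step_sum P f [::] = 0.
Proof. exact: big_ord0. Qed.

Lemma step_sum_cons P f s w :
  step_sum P f (s :: w) = P s * f [::] + step_sum P (fun u => f (s :: u)) w.
Proof.
rewrite /step_sum big_mkcond big_ord_recl /= -big_mkcond /=.
by case: (P s); rewrite ?mul1n.
Qed.

Lemma step_sum_cat P f p q :
  step_sum P f (p ++ q) = step_sum P f p + step_sum P (fun u => f (p ++ u)) q.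
Proof.
elim: p f => [|s p IHp] f; first by rewrite !step_sum_nil.
by rewrite cat_cons !step_sum_cons IHp addnA.
Qed.

Lemma eq_step_sum P f g w : f =1 g -> step_sum P f w = step_sum P g w.
Proof. by move=> fg; apply: eq_bigr => i _. Qed.

(** As [f] ignores order, only the two exchanged steps change their contributions. These appear
    crosswise as the added terms, which avoids subtraction. Both [area] and [ED_pairs] are sums of
    this form. *)
Lemma step_sum_swap P f p s t q :
    (forall u v, perm_eq u v -> f u = f v) ->
  step_sum P f (p ++ s :: t :: q) + (P t * f p + P s * f (rcons p t)) =
  step_sum P f (p ++ t :: s :: q) + (P s * f p + P t * f (rcons p s)).
Proof.
move=> fP; rewrite !step_sum_cat !step_sum_cons !cats0 !cats1.
rewrite (@eq_step_sum P (fun u => f (p ++ s :: t :: u))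
                        (fun u => f (p ++ t :: s :: u)) q); last first.
  move=> u; apply: fP; rewrite perm_cat2l.
  by rewrite -[s :: t :: u]/([:: s] ++ [:: t] ++ u) perm_catCA.
lia.
Qed.

Lemma endpoint_perm u v : perm_eq u v -> endpoint u = endpoint v.
Proof. by move=> /permP uv; rewrite /endpoint !uv. Qed.

Lemma area_swap p (s : step) q : s != E ->
    (endpoint p).1 < (endpoint p).2 ->
  area (p ++ s :: E :: q) = (area (p ++ E :: s :: q)).+1.
Proof.
move=> sE lt_p; pose h u := (endpoint u).2 - (endpoint u).1.
have := @step_sum_swap (fun t => t != E) h p s E q.
rewrite /= sE => /(_ _)/wrap[|eq_area].
  by move=> u v /endpoint_perm; rewrite /h => ->.
have areaE w : area w = step_sum (fun t => t != E) h w by [].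
(* As [p] ends strictly above the diagonal, the truncated difference really drops by one after an
   [E]. *)
have hE : h p = (h (rcons p E)).+1.
  by move: lt_p; rewrite /h /endpoint -cats1 !count_cat /=; lia.
by move: eq_area; rewrite !areaE hE !mul0n !mul1n; lia.
Qed.

(** A closed form of [numph] on moving words ([numph_moving]) that is easy to follow under an
    exchange. *)
Definition ED_pairs (w : word) : nat := step_sum (pred1 D) (count_mem E) w.

Lemma ED_pairs_swap p (s : step) q : s != E ->
  ED_pairs (p ++ E :: s :: q) = ED_pairs (p ++ s :: E :: q) + (s == D).
Proof.
move=> sE; have := @step_sum_swap (pred1 D) (count_mem E) p s E q.
rewrite /ED_pairs => /(_ _)/wrap[|]; first by move=> u v /permP.
by rewrite -!cats1 !count_cat /=; case: s sE => //= _; lia.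
Qed.

Lemma area_NED bs : blocks bs -> area (flatten bs) = 0.
Proof.
move=> bsP; pose h c u := (c + (endpoint u).2) - (c + (endpoint u).1).
(* Each block advances both coordinates by one, so the remaining blocks see the same sum with the
   offset [c.+1]. *)
suff: forall c, step_sum (fun t => t != E) (h c) (flatten bs) = 0 by move/(_ 0).
elim: bs bsP => [|b bs IHbs] /=; first by move=> _ c; rewrite step_sum_nil.
case/andP=> bP /IHbs{}IHbs c; rewrite step_sum_cat.
rewrite (@eq_step_sum _ _ (h c.+1) (flatten bs)) ?IHbs ?addn0.
  by move: bP; rewrite !inE => /orP[]/eqP->;
    rewrite !step_sum_cons step_sum_nil /h /endpoint /=; lia.
by move: bP; rewrite !inE => /orP[]/eqP-> u; rewrite /h /endpoint /=; lia.
Qed.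

(** * The effect of [phi_step] on these shapes *)

Lemma phi_step_last p s y m : E \notin s :: y ->
  phi_step (p ++ E :: s :: y ++ nseq m E) = p ++ s :: E :: y ++ nseq m E.
Proof.
move=> sy; set w := p ++ _.
have sE : s != E by move: sy; rewrite inE negb_or eq_sym => /andP[].
have nth_w i : nth E w (size p + i) = nth E (E :: s :: y ++ nseq m E) i.
  by rewrite /w nth_cat ltnNge leq_addr /= addKn.
have nth_p : nth E w (size p) = E by rewrite -[size p]addn0 nth_w.
have nth_p1 : nth E w (size p).+1 = s by rewrite -addn1 nth_w.
have size_w : size w = size p + (2 + (size y + m)).
  by rewrite /w size_cat /= size_cat size_nseq.
(* The index [size p] is exchangeable and no later one is, so it ends the list of candidates. *)
have lastw : [seq i <- iota 0 (size w) | exchangeable w i]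
    = rcons [seq i <- iota 0 (size p) | exchangeable w i] (size p).
  have p_ex : exchangeable w (size p).
    by rewrite /exchangeable nth_p nth_p1 /= sE size_w andbT; lia.
  rewrite size_w iotaD filter_cat -cats1; congr (_ ++ _).
  rewrite add0n -[2 + _]/(1 + (1 + (size y + m))) iotaD filter_cat.
  rewrite [[seq i <- iota _ 1 | _]]/= p_ex -[RHS]cats0; congr (_ ++ _).
  apply/eqP; rewrite -[_ == _]negbK -has_filter; apply/hasPn => i.
  rewrite mem_iota addn1 => /andP[lt_i _].
  have -> : i = size p + (i - size p - 1).+1 by lia.
  move: (_ - 1) => j; rewrite /exchangeable -addnS !nth_w /=.
  rewrite -[s :: y ++ _]cat_cons !nth_cat.
  (* Inside [s :: y] the letter at [i] is not [E]; in the final run the next letter is [E], past the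
     end by the default of [nth]. *)
  have [lt_j|le_j] := ltnP j (size (s :: y)).
    rewrite (_ : nth E (s :: y) j == E = false) ?andbF //.
    by apply: contraNF sy => /eqP <-; apply: mem_nth.
  by rewrite (leq_gtF (ltnW le_j)) !nth_nseq !if_same !eqxx !andbF.
have -> : phi_step w = exchange w (size p).
  rewrite /phi_step lastw; case: filter => //= i r.
  by rewrite last_rcons.
rewrite /exchange nth_p nth_p1 /w take_size_cat //.
by rewrite -addn2 addnC -drop_drop drop_size_cat //= drop0.
Qed.

Lemma phi_step_moving bs x s y : E \notin s :: y ->
  phi_step (moving bs x (s :: y)) = moving bs (rcons x s) y.
Proof.
move=> sy; rewrite /moving -cats1 -cat_cons catA phi_step_last //.
by rewrite count_cat /= addn0 addnA -!catA.
Qed.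

(** Blocks are peeled off from the right: a last [D] joins [z]; a last [NE] provides the moving [E]
    if [z] is nonempty, and otherwise is itself the settled word of [[:: N]]. *)
Lemma active_or_stuck bs z : blocks bs -> E \notin z ->
  active (flatten bs ++ settled z) \/ stuck (flatten bs ++ settled z).
Proof.
elim/last_ind: bs z => [|bs b IHbs] z.
  by move=> _ zE; right; exists z.
rewrite /blocks all_rcons flatten_rcons -catA => /andP[bP bsP] zE.
move: bP; rewrite !inE => /orP[]/eqP->.
  case: z zE => [|s z] zE; last by left; exists bs, [::], s, z.
  by rewrite -[_ ++ settled _]/(settled [:: N]); apply: IHbs.
by rewrite -[[:: D] ++ _]/(settled (D :: z)); apply: IHbs.
Qed.

Lemma phi_step_active w : active w -> active (phi_step w) \/ stuck (phi_step w).
Proof.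
move=> [bs [x [s [y [bsP xE syE ->]]]]]; rewrite phi_step_moving //.
move: syE; rewrite inE negb_or => /andP[sE yE].
have xsE : E \notin rcons x s by rewrite mem_rcons inE negb_or sE.
case: y yE => [_|t y tyE]; last by left; exists bs, (rcons x s), t, y.
(* With [y] exhausted the moving [E] has joined the final run, and the [E] of the last [NE] of [bs],
   if any, takes over. *)
suff -> : moving bs (rcons x s) [::] = flatten bs ++ settled (N :: rcons x s).
  by apply: active_or_stuck => //; rewrite inE negb_or.
  by rewrite /moving /settled /= addn0.
Qed.

(** * Deleting the [D] steps, and the heights reached by the bounce path *)

Lemma endpoint_Gam w : endpoint (Gam w) = (count_mem E w, count_mem N w).
Proof. by rewrite /endpoint /Gam; elim: w => [|[] w [? ?]] //=; congr pair; lia. Qed.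

Lemma Gam_cat u v : Gam (u ++ v) = Gam u ++ Gam v.
Proof. exact: filter_cat. Qed.

(** Without [D] steps only an [E] changes the abscissa, so each column holds at most one east
    step. *)
Lemma mem_east_starts p q y : D \notin p ++ E :: q ->
  ((count_mem E p, y) \in east_starts (p ++ E :: q)) = (y == count_mem N p).
Proof.
set w := p ++ E :: q => wD.
have cD i : count_mem D (take i w) = 0.
  by apply/count_memPn; apply: contra wD => /mem_take.
have pD : count_mem D p = 0 by have := cD (size p); rewrite take_size_cat.
apply/mapP/eqP => [[i]|->]; last first.
  exists (size p); last by rewrite /start /endpoint take_size_cat // pD !addn0.
  by rewrite mem_filter mem_iota nth_cat ltnn subnn size_cat /=; lia.
rewrite mem_filter mem_iota => /andP[/eqP iE /andP[_ lt_i]].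
rewrite /start /endpoint !cD !addn0 => -[Ei ->].
suff -> : i = size p by rewrite take_size_cat.
have cE j1 j2 : j1 < j2 -> j1 < size w -> nth N w j1 = E ->
    count_mem E (take j1 w) < count_mem E (take j2 w).
  move=> lt_j ltw jE; rewrite -(subnKC lt_j) takeD (take_nth N) // jE.
  by rewrite count_cat -cats1 count_cat /=; lia.
have take_p : take (size p) w = p by rewrite take_size_cat.
have [lt_ip|lt_pi|//] := ltngtP i (size p).
  by have := cE _ _ lt_ip lt_i iE; rewrite take_p -Ei ltnn.
have := cE _ _ lt_pi; rewrite take_p -Ei ltnn size_cat nth_cat ltnn subnn /=.
by move=> abs; have : false by apply: abs => //; lia.
Qed.

Lemma north_untilE w p q j : D \notin w -> w = p ++ E :: q ->
  j = count_mem E p -> j <= count_mem N p -> north_until w j = count_mem N p.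
Proof.
move=> wD w_eq -> le_j; rewrite /north_until.
rewrite (@eq_find _ _ (pred1 (count_mem N p))); last first.
  by move=> y; rewrite /= w_eq mem_east_starts // -w_eq.
have := count_size (pred1 N) p.
move: (count_mem N p) (count_mem E p) le_j => t j0 le_j le_t.
(* The height lies in the searched range, so [find] returns its index and not the length of the
   range. *)
have mem_t : t \in iota j0 (size w).
  by rewrite mem_iota le_j w_eq size_cat /= !addnS ltnS (leq_trans le_t) //
    addnCA leq_addr.
have := nth_index 0 mem_t; rewrite nth_iota //.
by rewrite -[X in _ < X](size_iota j0 (size w)) index_mem.
Qed.

Lemma Gam_blocks bs : blocks bs ->
  Gam (flatten bs) = flatten (nseq (count_mem N (flatten bs)) [:: N; E]).
Proof.
elim: bs => //= b bs IHbs /andP[bP /IHbs{}IHbs].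
by rewrite Gam_cat IHbs count_cat; move: bP; rewrite !inE => /orP[]/eqP->.
Qed.

Lemma Gam_noE x : E \notin x -> Gam x = nseq (count_mem N x) N.
Proof. by elim: x => [|[] x IHx] //=; rewrite inE //= => /IHx->. Qed.

Lemma count_flatten_NE (s : step) a :
  count_mem s (flatten (nseq a [:: N; E])) = a * (s != D).
Proof. by elim: a => //= a ->; case: s => /=; lia. Qed.

Lemma count_noE x : E \notin x -> count_mem E x = 0.
Proof. exact: (count_memPn (x := E)). Qed.

(** * Bounce path of the Dyck path of a moving word *)

Section MovingTurns.

Variables a b c : nat.

(** This is [Gam (moving bs x y)], where [a], [b] and [c] count the [N]'s of [flatten bs], [x] and
    [y] ([Gam_moving]). *)
Let G : word := flatten (nseq a [:: N; E]) ++
  nseq b.+1 N ++ E :: nseq c N ++ nseq (b + c) E.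

Let k := a + b.+1 + c.

Lemma count_G : count_mem N G = k.
Proof.
rewrite /G /k !(count_cat, count_flatten_NE) /= !(count_cat, count_nseq) /=.
by lia.
Qed.

Lemma D_notin_G : D \notin G.
Proof.
rewrite -has_pred1 has_count /G !(count_cat, count_flatten_NE) /=.
by rewrite !(count_cat, count_nseq) /=; lia.
Qed.

(** The bounce path makes [a] unit bounces along the [NE] blocks, then one of length [b.+1] below
    the moving [E], and, if [c > 0], a last one to [(k, k)]. *)
Lemma turns_G : turns G = [seq (j, j.+1) | j <- iota 0 a] ++
  (a, a + b.+1) :: (if 0 < c then [:: (a + b.+1, k)] else [::]).
Proof.
have GD := D_notin_G.
have NE_turns d fuel j : j + d = a -> turns_from G (d + fuel) j =
    [seq (i, i.+1) | i <- iota j d] ++ turns_from G fuel a.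
  elim: d j => [|d IHd] j; first by rewrite addn0 => ->.
  move=> jd; rewrite addSn /= count_G ifT; last by rewrite /k; lia.
  have -> : north_until G j = j.+1; last by rewrite IHd // -jd addnS.
  have G_eq : G = (flatten (nseq j [:: N; E]) ++ [:: N]) ++ E ::
      flatten (nseq d [:: N; E]) ++
      nseq b.+1 N ++ E :: nseq c N ++ nseq (b + c) E.
    by rewrite /G -{1}jd nseqD flatten_cat -!catA.
  by rewrite (north_untilE _ _ _ _ GD G_eq) !count_cat !count_flatten_NE /=; lia.
have turns_k fuel : turns_from G fuel k = [::].
  by case: fuel => //= fuel; rewrite count_G ltnn.
rewrite /turns count_G -{1}[k]addnA (NE_turns a _ 0) //; congr (_ ++ _).
rewrite addSn /= count_G ifT; last by rewrite /k; lia.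
have -> : north_until G a = a + b.+1.
  rewrite (@north_untilE G (flatten (nseq a [:: N; E]) ++ nseq b.+1 N)
             (nseq c N ++ nseq (b + c) E)) ?GD //;
  by rewrite /G -?catA // !count_cat !count_flatten_NE !count_nseq /=; lia.
congr (_ :: _); case c_eq: c => [|c'].
  by rewrite (_ : a + b.+1 = k) ?turns_k // /k c_eq addn0.
rewrite addnS /= count_G /k c_eq ifT; last by lia.
(* The east step in this column comes after the [a] block [E]'s, the moving [E] and [b] letters of
   the final run. *)
have -> : north_until G (a + b.+1) = a + b.+1 + c.
  rewrite (@north_untilE G (flatten (nseq a [:: N; E]) ++ nseq b.+1 N ++
             E :: nseq c N ++ nseq b E) (nseq c' E)) ?GD //;
  rewrite /G ?c_eq -?catA /= ?count_cat ?count_flatten_NE /= ?count_cat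
     ?count_nseq /= ?count_cat ?count_nseq /=; try lia.
  by rewrite -!catA /= -?catA /= nseqD.
rewrite -c_eq -/k turns_k /k; congr [:: (_, _)]; lia.
Qed.

(** The return at [a + b.+1] contributes [c], also when [c = 0], and a further return at [k]
    contributes nothing. *)
Lemma dyck_bounce_G : dyck_bounce G = \sum_(0 <= j < a) (k - j.+1) + c.
Proof.
rewrite /dyck_bounce turns_G big_cat big_map big_cons count_G /index_iota subn0.
congr (_ + _); rewrite (_ : k - _ = c) /=; last by rewrite /k; lia.
by case: ifP; rewrite ?big_cons big_nil /= ?subnn !addn0.
Qed.

End MovingTurns.

(** * Bounce of moving and stuck words *)

Lemma Gam_nseqE m : Gam (nseq m E) = nseq m E.
Proof. by elim: m => //= m ->. Qed.

Lemma Gam_moving bs x y : blocks bs -> E \notin x -> E \notin y ->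
  Gam (moving bs x y) = flatten (nseq (count_mem N (flatten bs)) [:: N; E]) ++
    nseq (count_mem N x).+1 N ++ E :: nseq (count_mem N y) N ++
    nseq (count_mem N x + count_mem N y) E.
Proof.
move=> bsP xE yE; rewrite /moving Gam_cat Gam_blocks //; congr (_ ++ _).
rewrite -[Gam (N :: _)]/(N :: Gam _) Gam_cat -[Gam (E :: _)]/(E :: Gam _).
by rewrite Gam_cat Gam_noE // Gam_noE // Gam_nseqE.
Qed.

Lemma blocks_balanced bs : blocks bs ->
  count_mem E (flatten bs) = count_mem N (flatten bs).
Proof.
elim: bs => //= b bs IHbs /andP[bP /IHbs{}IHbs].
by rewrite !count_cat IHbs; move: bP; rewrite !inE => /orP[]/eqP->.
Qed.

(** This makes every [E] of the blocks a peak step: it starts at one of the turns [(j, j.+1)] of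
    [turns_G]. *)
Lemma blocks_east bs i : blocks bs -> i < size (flatten bs) ->
    nth N (flatten bs) i = E ->
  count_mem E (take i (flatten bs)) < count_mem N (flatten bs) /\
  count_mem N (take i (flatten bs)) = (count_mem E (take i (flatten bs))).+1.
Proof.
elim: bs i => [|b bs IHbs] i //= /andP[bP bsP].
rewrite size_cat nth_cat take_cat count_cat.
case: (ltnP i (size b)) => lt_ib.
  move: bP lt_ib; rewrite !inE => /orP[]/eqP->.
    by case: i => [|[|i]].
  by case: i => [|[|i]].
move=> lt_i iE; case: (IHbs (i - size b) bsP _ iE); first by lia.
by move: bP; rewrite !inE => /orP[]/eqP-> /=; lia.
Qed.

Lemma count_take (s t : step) (w : word) d : d <= size w ->
  count (fun i => nth t w i == s) (iota 0 d) = count_mem s (take d w).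
Proof.
move=> le_d; rewrite -(map_nth_iota0 t le_d) count_map.
by apply: eq_count.
Qed.

(** Every [E] before a [D] is a peak step: it belongs to [bs] or is the moving one, since the final
    run comes after all [D]'s. *)
Lemma numph_moving bs x y : blocks bs -> E \notin x -> E \notin y ->
  numph (moving bs x y) = ED_pairs (moving bs x y).
Proof.
move=> bsP xE yE; set w := moving bs x y.
apply: eq_bigr => -[d /= lt_d] /eqP dD.
rewrite -(count_take E N) 1?ltnW //; apply: eq_in_count => i.
rewrite mem_iota /= add0n => lt_id; rewrite /is_peak_step.
have [iE|//] := eqVneq; rewrite endpoint_Gam Gam_moving // turns_G /=.
rewrite mem_cat inE; set a := count_mem N (flatten bs).
have w_eq : w = flatten bs ++ (N :: x) ++ E :: y ++
  nseq (count_mem N x + count_mem N y) E by [].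
move: iE dD; rewrite w_eq !(nth_cat, take_cat).
(* The index [i] is located in [flatten bs], in [N :: x], at the moving [E], in [y] or in the final
   run; only the first and third places can hold an [E] before a [D]. *)
have [lt_i iE _|le_i] := ltnP i (size (flatten bs)).
  have [lt_a ->] := blocks_east _ _ bsP lt_i iE.
  by apply/orP; left; apply/mapP; exists (count_mem E (take i (flatten bs)));
    rewrite // mem_iota.
have [lt_d'|le_d] := ltnP d (size (flatten bs)); first by lia.
have [lt_i iE _|le_i'] := ltnP (i - _) _.
  case/negP: xE; have : E \in N :: x by rewrite -iE mem_nth.
  by [].
have [lt_d'|le_d'] := ltnP (d - _) _; first by lia.
set i' := i - _ - _; have [i0 _ _|i_gt0] := posnP i'.
  apply/orP; right; apply/orP; left; rewrite i0 take0 cats0 !count_cat.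
  by rewrite blocks_balanced //= count_noE // add1n !addn0.
have [d'] : exists d', d - size (flatten bs) - size (N :: x) = d'.+1.
  by exists (d - size (flatten bs) - size (N :: x)).-1;
    rewrite /i' in i_gt0; lia.
move=> d_eq; rewrite d_eq -(prednK i_gt0) /= !nth_cat.
case: ltnP => [lt_i|le_iy] iE.
  by case/negP: yE; rewrite -iE mem_nth.
case: ltnP => [lt_dy|_]; first by rewrite /i' in i_gt0 le_iy; lia.
by rewrite nth_nseq if_same.
Qed.

Lemma bounce_moving bs x y : blocks bs -> E \notin x -> E \notin y ->
  let a := count_mem N (flatten bs) in
  let k := a + (count_mem N x).+1 + count_mem N y in
  bounce (moving bs x y) =
    \sum_(0 <= j < a) (k - j.+1) + count_mem N y + ED_pairs (moving bs x y).
Proof.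
move=> bsP xE yE /=.
by rewrite /bounce numph_moving // Gam_moving // dyck_bounce_G.
Qed.

(** The Dyck path consists of [N]'s followed by [E]'s, so its only return, if any, is at the end and
    contributes [0]; and no [E] precedes a [D]. *)
Lemma bounce_stuck w : stuck w -> bounce w = 0.
Proof.
case=> x xE ->; rewrite /bounce /settled.
have -> : dyck_bounce (Gam (x ++ nseq (count_mem N x) E)) = 0.
  rewrite Gam_cat Gam_noE // Gam_nseqE; move: (count_mem N x) => m.
  set G := nseq m N ++ nseq m E.
  have Gm : count_mem N G = m by rewrite count_cat !count_nseq /=; lia.
  have north0 : 0 < m -> north_until G 0 = m.
    case: m @G Gm => // m G Gm _.
    rewrite (@north_untilE _ (nseq m.+1 N) (nseq m E)) ?count_nseq //=.
      by rewrite mul1n.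
    by rewrite /G mem_cat !mem_nseq !andbF.
  have turns_m f : turns_from G f m = [::] by case: f => //= f; rewrite Gm ltnn.
  rewrite /dyck_bounce /turns Gm; move: G Gm north0 turns_m.
  case: m => [|m] G Gm north0 turns_m /=; first by rewrite big_nil.
  by rewrite Gm north0 // turns_m big_cons big_nil subnn.
apply: big1 => -[d /= lt_d] /eqP.
rewrite nth_cat; case: ltnP => [lt_dx _|_]; last by rewrite nth_nseq if_same.
apply/eqP; rewrite -leqn0 leqNgt -has_count; apply/hasPn => i.
rewrite mem_iota add0n => /andP[_ lt_i]; rewrite /is_peak_step nth_cat.
rewrite (ltn_trans lt_i lt_dx) negb_and; apply/orP; left.
by apply: contraNneq xE => <-; rewrite mem_nth // (ltn_trans lt_i).
Qed.

(** * Change of the two statistics along a sequence *)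

Lemma area_active w : active w -> area (phi_step w) = (area w).+1.
Proof.
case=> [bs [x [s [y [bsP xE syE ->]]]]].
have sE : s != E by move: syE; rewrite inE negb_or eq_sym => /andP[].
rewrite /moving -cat_cons catA phi_step_last // area_swap //.
(* The blocks are balanced, so the [N] in front of [x] puts the prefix strictly above the
   diagonal. *)
rewrite /endpoint !count_cat /= (count_noE x) //.
by rewrite blocks_balanced // ltn_add2r ltn_add2l.
Qed.

(** In [bounce_moving] the value of [k] is unchanged. If [s] is [N], the count of [N]'s after the
    moving [E] drops by one; if [s] is [D], [ED_pairs] does. *)
Lemma bounce_active w : active w -> bounce w = (bounce (phi_step w)).+1.
Proof.
case=> [bs [x [s [y [bsP xE syE ->]]]]].
move: (syE); rewrite inE negb_or eq_sym => /andP[sE yE].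
have xsE : E \notin rcons x s by rewrite mem_rcons inE negb_or eq_sym sE.
have ED : ED_pairs (moving bs x (s :: y)) =
    ED_pairs (moving bs (rcons x s) y) + (s == D).
  by rewrite -phi_step_moving // /moving -cat_cons catA phi_step_last //
    ED_pairs_swap.
rewrite phi_step_moving // !bounce_moving // ED -cats1 count_cat /=.
set a := count_mem N _; set l := count_mem N x; set m := count_mem N y.
have -> : a + (l + ((s == N) + 0)).+1 + m = a + l.+1 + ((s == N) + m) by lia.
by move: (\sum_(_ <= _ < _) _) => S; case: s sE {syE xsE ED} => //= _; lia.
Qed.

(** * Recovering the initial word of a sequence *)

Definition non_E (w : word) : word := [seq s <- w | s != E].

Lemma non_E_active w : active w -> non_E (phi_step w) = non_E w.
Proof.
case=> [bs [x [s [y [bsP xE syE ->]]]]].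
rewrite phi_step_moving // /moving /non_E -cats1.
rewrite count_cat /= addn0 addnA !filter_cat /= !filter_cat /= -catA /=.
by rewrite -cat1s filter_cat /=; case: (s != E).
Qed.

Definition NED_of (u : word) : word :=
  flatten [seq if s == N then [:: N; E] else [:: s] | s <- u].

Lemma NED_ofK bs : blocks bs -> NED_of (non_E (flatten bs)) = flatten bs.
Proof.
elim: bs => //= b bs IHbs /andP[bP /IHbs].
rewrite /NED_of /non_E filter_cat map_cat flatten_cat => ->.
by move: bP; rewrite !inE => /orP[]/eqP->.
Qed.

Lemma iter_phi_step bs v : blocks bs -> v <= bounce (flatten bs) ->
  let w := iter v phi_step (flatten bs) in
  [/\ active w \/ stuck w, area w = v, v + bounce w = bounce (flatten bs)
    & NED_of (non_E w) = flatten bs].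
Proof.
move=> bsP; elim: v => [_|v IHv lt_v] /=.
  rewrite area_NED // NED_ofK //; split => //.
  by have := active_or_stuck bs [::] bsP isT; rewrite cats0.
(* A stuck word would have bounce [0], forcing [v] to be the full bounce, against [lt_v]. *)
have [[wA|/bounce_stuck w0] area_w bounce_w non_E_w] := IHv (ltnW lt_v);
  last by lia.
split; first exact: phi_step_active.
- by rewrite area_active // area_w.
- by rewrite -bounce_w (bounce_active _ wA) addnS.
- by rewrite non_E_active.
Qed.

Theorem proposition1 (n : nat) (hn : (0 < n)%N) :
  exists Omega : word -> word,
    set_bij (phi_image n) (phi_image n) Omega /\
    (forall p : word, phi_image n p ->
       area p = bounce (Omega p) /\ bounce p = area (Omega p)).
Proof.
(* The invariant [non_E] gives back the initial word. The word at position [v] has bounce [b - v],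
   for [b] the initial bounce, and that is its position in the reversed sequence. *)
pose Omega w := iter (bounce w) phi_step (NED_of (non_E w)).
have Omega_spec p : phi_image n p -> [/\ phi_image n (Omega p),
    Omega (Omega p) = p, area p = bounce (Omega p) & bounce p = area (Omega p)].
  case=> w wn; have [bs [_ bsP w_eq]] := wn.
  rewrite /= /phi => /trajectP[v]; rewrite ltnS w_eq => le_v p_eq.
  have [_ area_p bounce_p NED_p] := iter_phi_step bs v bsP le_v.
  rewrite -p_eq in area_p bounce_p NED_p.
  have le_b : bounce p <= bounce (flatten bs) by rewrite -bounce_p leq_addl.
  have [_ area_O bounce_O NED_O] := iter_phi_step bs (bounce p) bsP le_b.
  have Op : Omega p = iter (bounce p) phi_step (flatten bs) by rewrite /Omega NED_p.
  rewrite -Op in area_O bounce_O NED_O.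
  (* Position and bounce add up to the initial bounce for both [p] and [Omega p], so a second
     reversal leads back to position [v]. *)
  have bO : bounce (Omega p) = v by lia.
  split; [|by rewrite {1}/Omega NED_O bO|by rewrite bO|by []].
  exists w; rewrite //= /phi w_eq; apply/trajectP.
  by exists (bounce p); rewrite ?ltnS.
exists Omega; split; last by move=> p /Omega_spec[].
split; first by move=> p /Omega_spec[].
  move=> p q; rewrite !inE => /Omega_spec[_ Kp _ _] /Omega_spec[_ Kq _ _] eq_O.
  by rewrite -Kp eq_O.
by move=> p /Omega_spec[Op Kp _ _]; exists (Omega p).
Qed.
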